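(* Let $n\ge 8$ be an even integer and let $D_n$ be the augmented source arc-path on $n$ vertices (defined in the context). Then $$\mathrm{DIN}(D_n)\ge\frac{n^2}{2}+\left\lfloor \frac{n^2}{16}-\frac{n}{4}+\frac{1}{4}\right\rfloor-1 .$$
   Context: All digraphs are finite and simple; an arc $(u,v)$ has tail $u$ and head $v$. A directed intersection representation of a digraph $D=(V,A)$ is an assignment $\varphi$ of a nonempty subset $\varphi(v)\subseteq\mathcal{C}$ of a finite ground set $\mathcal{C}$ (the color set) to each vertex $v\in V$ such that, for all distinct $u,v\in V$, $(u,v)\in A$ if and only if $|\varphi(u)\cap\varphi(v)|\ge 1$ and $|\varphi(u)|<|\varphi(v)|$. Every acyclic digraph admits such a representation. The directed intersection number $\mathrm{DIN}(D)$ is the smallest cardinality of a ground set $\mathcal{C}$ for which $D$ admits a directed intersection representation. For $m\ge1$ write $[m]=\{1,\dots,m\}$. For even $n\ge 8$, the augmented source arc-path $D_n$ has vertex set $\{v_1,\dots,v_n\}$ and arc set consisting of: (i) the arcs $(v_1,v_{2i})$ for $i\in[n/2]$ and the arcs $(v_j,v_{j+1})$ for $j\in[n-1]$; (ii) additional arcs among the vertices $v_3,v_5,\dots,v_{n-1}$, as follows. If $\frac{n-2}{2}$ is even, let $X=\{v_3,v_5,\dots,v_{n/2}\}$ and $Y=\{v_{n/2+2},v_{n/2+4},\dots,v_{n-1}\}$ (odd indices only), and add all arcs $(x,y)$ with $x\in X$, $y\in Y$ except $(v_{n/2},v_{n/2+2})$. If $\frac{n-2}{2}$ is odd, let $X=\{v_3,v_5,\dots,v_{n/2+1}\}$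 and $Y=\{v_{n/2+3},v_{n/2+5},\dots,v_{n-1}\}$ (odd indices only), and add all arcs $(x,y)$ with $x\in X$, $y\in Y$ except $(v_{n/2+1},v_{n/2+3})$. *)

(* Defs.v *)
From mathcomp Require Import all_boot all_order all_algebra.
From mathcomp Require Import zify.

Set Implicit Arguments.
Unset Strict Implicit.
Unset Printing Implicit Defensive.

Record digraph := Digraph {
  vertex :> finType;
  arc : rel vertex;
  arc_irr : irreflexive arc
}.

Definition acyclic (D : digraph) : Prop :=
  forall c : seq D, c != [::] -> ~~ cycle (@arc D) c.

Definition dir_rep (D : digraph) (C : finType)
    (phi : {ffun D -> {set C}}) : bool :=
  [forall v, phi v != set0] &&
  [forall u, forall v, (u != v) ==>
     (arc u v == (1 <= #|phi u :&: phi v|) && (#|phi u| < #|phi v|))].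

(* A ground set of cardinality m is taken to be 'I_m, without loss of
   generality by dir_rep_representable. *)
Definition representable (D : digraph) (m : nat) : bool :=
  [exists phi : {ffun D -> {set 'I_m}}, dir_rep phi].

Lemma dir_rep_representable (D : digraph) (C : finType)
    (phi : {ffun D -> {set C}}) :
  dir_rep phi -> representable D #|C|.
Proof.
case/andP=> /forallP phi0 /forallP phiA; apply/existsP.
exists [ffun v => enum_rank @: phi v]; apply/andP; split.
  by apply/forallP=> v; rewrite ffunE imset_eq0.
apply/forallP=> u; apply/forallP=> v; rewrite !ffunE.
rewrite -imsetI; last by move=> x y _ _; apply: enum_rank_inj.
by rewrite !card_imset; try exact: enum_rank_inj; move/forallP: (phiA u).
Qed.

Section AcyclicRepresentable.
Variables (D : digraph) (acD : acyclic D).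

Let rank (v : D) := #|[pred u | connect (@arc D) u v]|.

Let rank_lt u v : arc u v -> rank u < rank v.
Proof.
move=> uv; apply: proper_card; apply/properP; split.
  apply/subsetP=> w; rewrite !inE => wu; exact: connect_trans wu (connect1 uv).
exists v; rewrite !inE ?connect0 //; apply/negP=> /connectP[p vp up].
have /negP := acD (c := v :: p) isT; apply.
by rewrite /= rcons_path vp -up.
Qed.

(* The colors of v are its incident arcs, which realize exactly the required
   intersections, together with private colors making sizes grow with rank. *)
Let K := #|{: D * D}|.+1.
Let pad v := (rank v).+1 * K.
Let M := (#|D|.+1 * K).
Let inc (v : D) : {set D * D} :=
  [set a : D * D | arc a.1 a.2 && ((a.1 == v) || (a.2 == v))].
Let priv (v : D) : {set D * 'I_M} := [set b : D * 'I_M | (b.1 == v) && (b.2 < pad v)].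
Let phi : {ffun D -> {set D * D + D * 'I_M}} :=
  [ffun v => inl @: inc v :|: inr @: priv v].

Let pad_le v : pad v <= M.
Proof. by rewrite leq_mul2r ltnS max_card orbT. Qed.

Let card_priv v : #|priv v| = pad v.
Proof.
have -> : priv v = [set (v, widen_ord (pad_le v) i) | i : 'I_(pad v)].
  apply/setP=> -[w i]; rewrite inE /=; apply/andP/imsetP => [[/eqP-> lti]|].
    by exists (Ordinal lti) => //; congr (_, _); apply: val_inj.
  by case=> j _ [-> ->]; rewrite eqxx /=.
rewrite card_imset ?card_ord // => i j [] ij.
exact: val_inj.
Qed.

Let card_phi v : #|phi v| = #|inc v| + pad v.
Proof.
rewrite ffunE cardsU (_ : _ :&: _ = set0); last first.
  apply/setP=> x; rewrite !inE; apply/negP=> /andP[].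
  by case/imsetP=> a _ -> /imsetP[].
rewrite cards0 subn0 !card_imset ?card_priv //.
  by move=> ? ? [].
by move=> ? ? [].
Qed.

Lemma acyclic_representable : exists m, representable D m.
Proof.
exists #|{: D * D + D * 'I_M}|; apply: (@dir_rep_representable D _ phi).
have phi_lt u v : arc u v -> #|phi u| < #|phi v|.
  move=> /rank_lt uv; rewrite !card_phi.
  have : #|inc u| < K by rewrite ltnS max_card.
  have : (rank u).+1 * K + K <= pad v by rewrite -mulSnr leq_mul2r ltnS uv orbT.
  rewrite /pad; lia.
apply/andP; split; apply/forallP=> u.
  by rewrite -card_gt0 card_phi addn_gt0 [0 < pad u]muln_gt0 orbT.
apply/forallP=> v; apply/implyP=> uv; apply/eqP; apply/idP/andP.
  move=> a_uv; split; last exact: phi_lt.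
  apply/card_gt0P; exists (inl (u, v)); rewrite !ffunE !inE.
  by rewrite !imset_f // inE /= a_uv eqxx ?orbT.
case=> /card_gt0P[x xI] lt_uv; move: xI; rewrite !ffunE !inE => /andP[].
case/orP=> /imsetP[a + ->].
  rewrite inE => /andP[a_a au] /orP[]/imsetP[b bv] // [Eab].
  move: bv; rewrite -Eab inE a_a /= => av.
  have nlt : ~~ arc v u.
    by apply: contraL lt_uv => /phi_lt; rewrite -leqNgt => /ltnW.
  case/orP: au av a_a => /eqP E1 /orP[] /eqP E2.
  - by rewrite -E1 E2 eqxx in uv.
  - by rewrite E1 E2.
  - by rewrite E1 E2 (negPf nlt).
  - by rewrite -E1 E2 eqxx in uv.
rewrite inE => /andP[/eqP Eu _] /orP[]/imsetP[b bv] // [Eab].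
by move: bv; rewrite -Eab inE Eu (negPf uv).
Qed.

End AcyclicRepresentable.

Definition DIN (D : digraph) (acD : acyclic D) : nat :=
  ex_minn (acyclic_representable acD).
Arguments DIN D acD : clear implicits.

(* The index of the last vertex of X. *)
Definition lastX (n : nat) : nat :=
  if odd ((n - 2) %/ 2) then (n %/ 2).+1 else n %/ 2.

Definition inX (n i : nat) : bool := [&& odd i, 3 <= i & i <= lastX n].
Definition inY (n j : nat) : bool := [&& odd j, lastX n + 2 <= j & j <= n - 1].

(* i and j are the indices, between 1 and n, of v_i and v_j. *)
Definition asap_arc (n i j : nat) : bool :=
  [|| (i == 1) && ~~ odd j,
      j == i.+1
    | [&& inX n i, inY n j & (i, j) != (lastX n, lastX n + 2)]].

Lemma asap_arc_lt n i j : 0 < j -> asap_arc n i j -> i < j.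
Proof. by rewrite /asap_arc /inX /inY; lia. Qed.

(* The vertex v_i is the ordinal i - 1. *)
Definition asap_rel (n : nat) : rel 'I_n := fun u v => asap_arc n u.+1 v.+1.

Lemma asap_irr n : irreflexive (@asap_rel n).
Proof. by move=> u; apply/negP=> /asap_arc_lt; rewrite ltnn => /(_ isT). Qed.

Definition augmented_source_arc_path (n : nat) : digraph :=
  Digraph (@asap_irr n).

Lemma asap_acyclic n : acyclic (augmented_source_arc_path n).
Proof.
case=> [//|x p] _; apply/negP=> /= xp.
have /(order_path_min _) : path (fun u v : 'I_n => u < v) x (rcons p x).
  by apply: sub_path xp => u v; apply: asap_arc_lt.
by rewrite all_rcons ltnn => /(_ (fun _ _ _ => @ltn_trans _ _ _)).
Qed.
Arguments asap_acyclic n : clear implicits.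

(* Main.v *)
Require Import Defs.
From mathcomp Require Import all_boot all_order all_algebra.
From mathcomp Require Import zify ring lra.

(** The path v_1 -> v_2 -> ... -> v_n forces the color sets to grow strictly
    with the index, so an intersection of two of them is always read as an arc
    and non-adjacent vertices must receive disjoint sets
    ([palette_disjoint]).  Three consequences give the bound.

    - The vertices of even index are independent, so their color sets are
      pairwise disjoint.  Each of them meets the set of v_1, which therefore
      has at least n/2 colors ([card_palette1]); growth along the path gives
      v_j at least n/2 + j - 1 colors ([card_palette_ge]).  Summed over the
      even indices this is n^2/2.

    - An arc from X to Y needs a color common to its ends.  That color occurs
      at no vertex of even index, since such a vertex is adjacent to both ends
      only if these are its two neighbours on the path, and the only pair of
      X * Y of that shape is the one that was left out.

    - X and Y are independent, so distinct arcs from X to Y use distinct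
      colors.

    Hence the color sets of the even vertices and the intersections along the
    arcs from X to Y are pairwise disjoint ([block_disjoint]), and the number
    of colors is at least n^2/2 + (|X||Y| - 1).  With k = (n - 2)/2 the sets X
    and Y have sizes k/2 rounded up and down, so |X||Y| is the integer part of
    k^2/4 = n^2/16 - n/4 + 1/4. *)

Set Implicit Arguments.
Unset Strict Implicit.
Unset Printing Implicit Defensive.

Lemma sum_card_disjoint_le (I T : finType) (A : {set T}) (B : I -> {set T}) :
    (forall i, B i \subset A) ->
    (forall i j, i != j -> [disjoint B i & B j]) ->
  \sum_i #|B i| <= #|A|.
Proof.
move=> BA dB; under eq_bigr do rewrite -sum1_card.
rewrite -(partition_disjoint_bigcup _ (fun=> 1)) // sum1_card subset_leq_card //.
exact/bigcupsP.
Qed.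

Lemma sum_consecutive_odd c h : \sum_(i < h) (c + i.*2.+1) = c * h + h * h.
Proof.
elim: h => [|h IH]; first by rewrite big_ord0; lia.
rewrite big_ord_recr /= IH; lia.
Qed.

(** The color set of v_i for an index i between 1 and n, so that indices can be
    computed with as natural numbers; it is empty above n. *)
Definition palette n (C : finType) (phi : {ffun 'I_n -> {set C}}) (i : nat) :
    {set C} :=
  odflt set0 (omap phi (insub i.-1)).

Section Representation.
Variables (k : nat) (C : finType).
(* As k = (n - 2)/2, the sets X and Y have uphalf k and k./2 elements. *)
Let n := k.+1.*2.
Variable phi : {ffun augmented_source_arc_path n -> {set C}}.
Hypothesis rep : dir_rep phi.
Let f := palette phi.

Lemma palette_arc i j : 0 < i <= n -> 0 < j <= n -> i != j ->
  asap_arc n i j = (0 < #|f i :&: f j|) && (#|f i| < #|f j|).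
Proof.
move=> /andP[i0 iN] /andP[j0 jN] ij.
have iP : i.-1 < n by lia.
have jP : j.-1 < n by lia.
case/andP: rep => _ /forallP/(_ (Ordinal iP))/forallP/(_ (Ordinal jP)).
have -> /= : Ordinal iP != Ordinal jP by rewrite -val_eqE /=; lia.
move/eqP; rewrite /= /asap_rel /= !prednK // => ->.
by rewrite /f /palette !insubT.
Qed.

Lemma card_palette_step i d : 0 < i -> i + d <= n ->
  #|f i| + d <= #|f (i + d)|.
Proof.
move=> i0; elim: d => [|d IH] idn; first by rewrite !addn0.
have : asap_arc n (i + d) (i + d).+1 by rewrite /asap_arc eqxx orbT.
rewrite palette_arc; try lia.
have {}IH : #|f i| + d <= #|f (i + d)| by apply: IH; lia.
by move=> /andP[_ lt_f]; rewrite !addnS; apply: leq_ltn_trans lt_f.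
Qed.

Lemma palette_disjoint i j : 0 < i -> i < j <= n -> ~~ asap_arc n i j ->
  [disjoint f i & f j].
Proof.
move=> i0 /andP[ij jn]; rewrite palette_arc; try lia.
have -> : #|f i| < #|f j|.
  by move: (@card_palette_step i (j - i)); rewrite subnKC; lia.
by rewrite andbT -eqn0Ngt cards_eq0 setI_eq0.
Qed.

Lemma palette_disjoint_sym i j : 0 < i <= n -> 0 < j <= n -> i != j ->
  ~~ asap_arc n i j -> ~~ asap_arc n j i -> [disjoint f i & f j].
Proof.
move=> iN jN ij nij nji; case: (ltngtP i j) => [lij|lji|eij]; last by lia.
  by apply: palette_disjoint => //; lia.
by rewrite disjoint_sym; apply: palette_disjoint => //; lia.
Qed.

Let lastXE : lastX n = (uphalf k).*2.+1.
Proof.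
rewrite /lastX /n (_ : (_ - 2) %/ 2 = k); last by lia.
rewrite (_ : _ %/ 2 = k.+1); last by lia.
by rewrite uphalf_half; have := odd_double_half k; case: (odd k); lia.
Qed.

(* Indices along the path of the i-th even vertex, the i-th vertex of X and the
   j-th vertex of Y, each counted from 0. *)
Let ev i := i.*2.+2.
Let xv i := i.*2.+3.
Let yv j := (uphalf k).*2 + j.*2.+3.

Lemma even_disjoint i j : i < k.+1 -> j < k.+1 -> i != j ->
  [disjoint f (ev i) & f (ev j)].
Proof.
move=> ik jk ij; apply: palette_disjoint_sym;
  rewrite /asap_arc /inX /inY ?lastXE /ev /n; lia.
Qed.

(** The arcs from v_1 to the vertices of even index need distinct colors,
    because the sets of these vertices are disjoint. *)
Lemma card_palette1 : k.+1 <= #|f 1|.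
Proof.
pose B (i : 'I_k.+1) := f 1 :&: f (ev i).
apply: (@leq_trans (\sum_i #|B i|)).
  rewrite -[leqLHS]card_ord -sum1_card; apply: leq_sum => i _.
  have : asap_arc n 1 (ev i) by rewrite /asap_arc /ev /=; lia.
  by rewrite palette_arc => [/andP[]| | |] //; rewrite /ev /n; have := ltn_ord i; lia.
apply: sum_card_disjoint_le => [i|i j ij]; first exact: subsetIl.
apply: disjointWl (subsetIr _ _) _; apply: disjointWr (subsetIr _ _) _.
exact: even_disjoint.
Qed.

Lemma card_palette_ge i : i < n -> k.+1 + i <= #|f i.+1|.
Proof.
move=> iN; apply: leq_trans (@card_palette_step 1 i isT iN).
by rewrite leq_add2r card_palette1.
Qed.

Let omitted (p : 'I_(uphalf k) * 'I_k./2) :=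
  (p.1.+1 == uphalf k) && (p.2 == 0 :> nat).

(** The disjoint sets of colors that are counted: the color sets of the even
    vertices and, for each pair of X * Y, the colors common to its two ends.
    Giving the omitted pair the empty set keeps the whole product as index
    type; it accounts for the final -1 in the bound. *)
Let block (b : 'I_k.+1 + 'I_(uphalf k) * 'I_k./2) : {set C} :=
  match b with
  | inl i => f (ev i)
  | inr p => if omitted p then set0 else f (xv p.1) :&: f (yv p.2)
  end.

Let even_arc_disjoint (i : 'I_k.+1) p : [disjoint block (inl i) & block (inr p)].
Proof.
rewrite /=; case: ifPn => [_|]; first by rewrite disjoint_sym disjoints_subset sub0set.
case: p => x y; rewrite /omitted /= => nom.
have := ltn_ord i; have := ltn_ord x; have := ltn_ord y => yk xk ik.
(* v_(ev i) is adjacent to v_(xv x) only if i is x or x + 1; in these cases it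
   is not adjacent to v_(yv y), as the pair (x, y) is not the omitted one. *)
have [xi|nxi] := boolP ((i == x :> nat) || (i == x.+1 :> nat)).
  apply: disjointWr (subsetIr _ _) _; apply: palette_disjoint_sym;
    rewrite /asap_arc /inX /inY ?lastXE /ev /yv /n; lia.
apply: disjointWr (subsetIl _ _) _; apply: palette_disjoint_sym;
  rewrite /asap_arc /inX /inY ?lastXE /ev /xv /n; lia.
Qed.

Let arc_arc_disjoint p q : p != q -> [disjoint block (inr p) & block (inr q)].
Proof.
rewrite /=; case: ifP => [_|_]; first by rewrite disjoints_subset sub0set.
case: ifP => [_|_]; first by rewrite disjoint_sym disjoints_subset sub0set.
case: p q => x y [x' y'] /=; rewrite xpair_eqE negb_and -!val_eqE /=.
have := ltn_ord x; have := ltn_ord y; have := ltn_ord x'; have := ltn_ord y'.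
move=> yk' xk' yk xk /orP[] ne.
  apply: disjointWl (subsetIl _ _) _; apply: disjointWr (subsetIl _ _) _.
  apply: palette_disjoint_sym; rewrite /asap_arc /inX /inY ?lastXE /xv /n; lia.
apply: disjointWl (subsetIr _ _) _; apply: disjointWr (subsetIr _ _) _.
apply: palette_disjoint_sym; rewrite /asap_arc /inX /inY ?lastXE /yv /n; lia.
Qed.

Lemma block_disjoint b c : b != c -> [disjoint block b & block c].
Proof.
case: b c => [i|p] [j|q] bc.
- by apply: even_disjoint => //; apply: contraNneq bc => /val_inj->.
- exact: even_arc_disjoint.
- by rewrite disjoint_sym; apply: even_arc_disjoint.
- by apply: arc_arc_disjoint; apply: contraNneq bc => ->.
Qed.

Lemma card_arc_block_gt0 p : ~~ omitted p -> 0 < #|block (inr p)|.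
Proof.
move=> nom; rewrite /= (negPf nom); case: p nom => x y; rewrite /omitted /= => nom.
have := ltn_ord x; have := ltn_ord y => yk xk.
have : asap_arc n (xv x) (yv y).
  rewrite /asap_arc /inX /inY ?lastXE xpair_eqE /xv /yv /n; lia.
by rewrite palette_arc => [/andP[]| | |] //; rewrite /xv /yv /n; lia.
Qed.

Lemma sum_card_arc_block : uphalf k * k./2 <= (\sum_p #|block (inr p)|).+1.
Proof.
have omitted_le1 : #|[pred p | omitted p]| <= 1.
  apply/card_le1_eqP => -[x y] [x' y'].
  rewrite !inE /omitted /= => /andP[/eqP xe /eqP ye] /andP[/eqP xe' /eqP ye'].
  by congr pair; apply: val_inj => /=; lia.
have := cardC [pred p | omitted p]; rewrite card_prod !card_ord => <-.
rewrite -addn1 addnC leq_add // -sum1_card big_mkcond leq_sum // => p _.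
by case: ifPn => // pP; apply: card_arc_block_gt0.
Qed.

Lemma card_colors_ge : 2 * (k.+1 * k.+1) + uphalf k * k./2 <= #|C|.+1.
Proof.
have := sum_card_disjoint_le (fun b => subsetT (block b)) block_disjoint.
rewrite big_sumType cardsT /= => leC.
have even_ge : k.+1 * k.+1 + k.+1 * k.+1 <= \sum_(i < k.+1) #|f (ev i)|.
  rewrite -sum_consecutive_odd; apply: leq_sum => i _.
  by apply: card_palette_ge; rewrite /n; have := ltn_ord i; lia.
have arc_ge := sum_card_arc_block; rewrite mul2n -addnn.
by apply: leq_trans (leq_add even_ge arc_ge) _; rewrite addnS ltnS.
Qed.

End Representation.

Import Order.TTheory GRing.Theory Num.Theory.
Local Open Scope ring_scope.

Lemma floor_quarter_square_le (k : nat) :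
  Num.floor (k%:R ^+ 2 / 4 : rat) <= (uphalf k * k./2)%N%:Z.
Proof.
rewrite -ltzD1 floor_lt_int.
have : (k * k < 4 * (uphalf k * k./2 + 1))%N.
  rewrite -(odd_double_half k) uphalf_half; case: (odd k); nia.
rewrite -(ltr_nat rat) !natrM natrD => lt4.
rewrite intrD -pmulrn natrM; lra.
Qed.

Theorem proposition3p3 (n : nat) (n_ge8 : (8 <= n)%N) (n_even : ~~ odd n) :
  n%:R ^+ 2 / 2
    + (Num.floor (n%:R ^+ 2 / 16 - n%:R / 4 + 1 / 4 : rat))%:~R - 1
  <= (DIN (augmented_source_arc_path n) (asap_acyclic n))%:R :> rat.
Proof.
rewrite /DIN; case: ex_minnP => m /existsP[phi rep] _.
have [k nk] : exists k, n = k.+1.*2 by exists (n./2.-1)%N; lia.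
subst n; have := card_colors_ge rep; rewrite card_ord -(ler_nat rat).
have nE : k.+1.*2%:R = 2 * k%:R + 2 :> rat.
  by rewrite -mul2n natrM -natr1; ring.
rewrite nE.
have -> : (2 * k%:R + 2) ^+ 2 / 16 - (2 * k%:R + 2) / 4 + 1 / 4
    = k%:R ^+ 2 / 4 :> rat by field.
have := floor_quarter_square_le k; rewrite -(ler_int rat) -pmulrn.
rewrite natrD !natrM -[m.+1%:R]natr1 -natr1 => floor_le colors_ge.
lra.
Qed.
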